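(* The uniform distribution on the interval $(0,1)$ is a Kies mixture with $\beta=1$ and $\lambda$ exponentially distributed with intensity one; that is, if $\lambda$ is exponentially distributed with intensity $1$ and $\beta=1$, then the function $F(t)=\mathbb E[H(t;\lambda,1)]$ is the CDF of the uniform distribution on $(0,1)$.
   Context: For constants $\lambda,\beta>0$ the Kies distribution on $(0,1)$ has CDF $H(t;\lambda,\beta)=1-\exp\left(-\lambda\left(\frac{t}{1-t}\right)^\beta\right)$, $t\in(0,1)$. The Kies mixture for positive random $\lambda,\beta$ is the distribution on $(0,1)$ with CDF $F(t)=\mathbb E[H(t;\lambda,\beta)]$, where $H(t;\lambda,\beta)$ is evaluated pointwise in $\omega$. The exponential distribution with intensity $\theta$ has density $\theta e^{-\theta x}$, $x>0$. *)

(* Defs.v *)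
From mathcomp Require Import all_boot all_order all_algebra.
From mathcomp Require Import all_classical all_reals all_analysis.

Set Implicit Arguments.
Unset Strict Implicit.
Unset Printing Implicit Defensive.

Import Order.TTheory GRing.Theory Num.Theory.
Import numFieldNormedType.Exports.

Local Open Scope classical_set_scope.
Local Open Scope ring_scope.

(* A CDF on the whole line: the formula on (0,1), extended by 0 on the left
   and by 1 on the right, since the law is carried by (0,1). *)
Definition kies_cdf (R : realType) (lambda beta t : R) : R :=
  if t <= 0 then 0
  else if 1 <= t then 1
  else 1 - expR (- (lambda * (t / (1 - t)) `^ beta)).

Definition kies_mixture_cdf (d : measure_display) (T : measurableType d)
    (R : realType) (P : probability T R) (lambda beta : {RV P >-> R}) (t : R) :
    \bar R :=
  'E_P[fun w => kies_cdf (lambda w) (beta w) t].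

(* Positivity of the parameters is almost sure: prescribing the law of a random
   variable gives no more than that. *)
Definition is_kies_mixture (d : measure_display) (T : measurableType d)
    (R : realType) (P : probability T R) (lambda beta : {RV P >-> R})
    (mu : probability (measurableTypeR R) R) : Prop :=
  [/\ {ae P, forall w, 0 < lambda w},
      {ae P, forall w, 0 < beta w},
      mu `]0, 1[%classic = 1%E
    & forall t : R, mu `]-oo, t]%classic = kies_mixture_cdf lambda beta t].

Definition exponentially_distributed (d : measure_display)
    (T : measurableType d) (R : realType) (P : probability T R)
    (X : {RV P >-> R}) (theta : R) : Prop :=
  forall A : set R, measurable A ->
    distribution P X A = exponential_prob theta A.

(* Main.v *)
(* As beta = 1, the mixture CDF is 1 - E[exp (- s * lambda)] with
   s = t / (1 - t).  The Laplace transform of the exponential law of intensity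
   one is 1 / (1 + s), because tilting an exponential density by exp (- s x)
   gives, up to a constant, the exponential density of intensity 1 + s; and
   1 - 1 / (1 + s) = t. *)
Require Import Defs.
From HB Require Import structures.
From mathcomp Require Import all_boot all_order all_algebra.
From mathcomp Require Import all_classical all_reals all_analysis.
From mathcomp Require Import measurable_realfun ring lra.

Import Order.TTheory GRing.Theory Num.Theory.
Import numFieldNormedType.Exports.

Local Open Scope classical_set_scope.
Local Open Scope ring_scope.

(** Vanishing of [p]-integrals on [mu]-null sets makes [nu] absolutely continuous, so the
    Radon-Nikodym change of variables applies; its derivative can be replaced by [p]. *)
Lemma integral_density {d : measure_display} {T : measurableType d}
    {R : realType} {mu : {sigma_finite_measure set T -> \bar R}}
    {nu : {finite_measure set T -> \bar R}} {p f : T -> \bar R} {E : set T} :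
  mu.-integrable setT p ->
  (forall A, measurable A -> nu A = \int[mu]_(x in A) p x)%E ->
  measurable E -> nu.-integrable E f ->
  (\int[nu]_(x in E) f x = \int[mu]_(x in E) (f x * p x))%E.
Proof.
move=> ip nuE mE intf.
have mp := measurable_int _ ip.
have numu : nu `<< mu.
  apply/null_content_dominatesP => A mA muA0; rewrite nuE//.
  by apply: null_set_integral => //; exact: measurable_funTS.
rewrite -(Radon_Nikodym_change_of_variables numu)//.
have mf := measurable_int _ intf.
have irn := @Radon_Nikodym_integrable _ _ _
  (charge_of_finite_measure nu) mu numu.
apply: ae_eq_integral => //.
- apply: emeasurable_funM => //.
  by apply: measurable_funTS; exact: measurable_int irn.
- by apply: emeasurable_funM => //; exact: measurable_funTS.
(* Uniqueness of densities: the derivative and [p] both integrate to [nu A] on every measurable [A]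
   inside [E]. *)
- apply: ae_eqe_mul2l; apply: integral_ae_eq => //.
  + exact: integrableS irn.
  + exact: measurable_funTS.
  + move=> A AE mA; rewrite -nuE//.
    by rewrite -(@Radon_Nikodym_integral _ _ _ (charge_of_finite_measure nu)).
Qed.

Lemma exponential_pdf_tilt (R : realType) (r s x : R) : 0 < r -> 0 < r + s ->
  expR (- (s * x)) * exponential_pdf r x =
  r / (r + s) * exponential_pdf (r + s) x.
Proof.
move=> r0 rs0; have [x0|x0] := ltP x 0.
  by rewrite !lt0_exponential_pdf// !mulr0.
rewrite !exponential_pdfE// mulrCA -expRD mulrA divfK ?gt_eqF//.
by congr (_ * expR _); ring.
Qed.

(** After tilting, the integrand is a difference of multiples of two exponential densities, each of
    total mass one. *)
Lemma integral_exponential_pdf_tilt (R : realType) (r s : R) :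
  0 < r -> 0 < r + s ->
  (\int[lebesgue_measure]_x ((1 - expR (- (s * x))) * exponential_pdf r x)%:E
   = (1 - r / (r + s))%:E)%E.
Proof.
move=> r0 rs0.
under eq_integral => x _.
  rewrite mulrBl mul1r exponential_pdf_tilt// EFinB EFinM; over.
have ir := integrable_exponential_pdf r0.
have irs := integrable_exponential_pdf rs0.
rewrite integralB//=; last exact: integrableZl.
by rewrite integralZl// !integral_exponential_pdf// mule1 EFinB.
Qed.

Section exponential_law.
Context {R : realType} {d : measure_display} {T : measurableType d}.
Context {P : probability T R} {X : {RV P >-> R}} {r : R}.
Hypothesis r0 : 0 < r.
Hypothesis expX : exponentially_distributed X r.

Lemma exponentially_distributed_gt0 : {ae P, forall w, 0 < X w}.
Proof.
exists (X @^-1` `]-oo, 0]); split.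
- by rewrite -[X in measurable X]setTI; exact: measurable_funP.
- have -> : P (X @^-1` `]-oo, 0]) = distribution P X `]-oo, 0] by [].
  (* The density is [r], not 0, at the point 0; this Lebesgue-null endpoint is dropped before using
     that the density vanishes on the negatives. *)
  rewrite expX// /exponential_prob -integral_itv_bndo_bndc; last first.
    apply/measurable_funTS/measurableT_comp => //.
    exact: measurable_exponential_pdf.
  by apply: integral0_eq => x; rewrite /= in_itv/= => /lt0_exponential_pdf ->.
- by move=> w /= /negP; rewrite in_itv/= -leNgt.
Qed.

(* Truncating at 0 changes nothing almost surely, and keeps the integrand
   bounded and nonnegative everywhere. *)
Lemma expectation_onem_expR_exponential (s : R) : 0 <= s ->
  ('E_P[fun w => (if 0 <= X w then 1 - expR (- (s * X w)) else 0)%R] =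
   (1 - r / (r + s))%:E)%E.
Proof.
move=> s0.
pose g x : R := if 0 <= x then 1 - expR (- (s * x)) else 0.
have g01 x : 0 <= g x <= 1.
  rewrite /g; case: ifPn => [x0|_]; last by rewrite lexx ler01.
  by rewrite subr_ge0 gerBl expR_ge0 expR_le1 oppr_le0 mulr_ge0.
have mg : measurable_fun [set: measurableTypeR R] (EFin \o g).
  apply/measurable_EFinP; apply: measurable_fun_ifT => //.
    exact: measurable_fun_ler.
  apply: measurable_funB => //; apply: measurableT_comp => //.
  by apply: measurableT_comp => //; exact: measurable_funM.
have mX : measurable_fun setT (X : T -> measurableTypeR R).
  exact: (measurable_funPT X).
(* [exponential_prob] is a measure on [measurableTypeR R], whose display
   differs from the one of the codomain of [X]. *)
pose Y : {mfun T >-> measurableTypeR R} :=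
  HB.pack (X : T -> measurableTypeR R) (isMeasurableFun.Build _ _ _ _ _ mX).
rewrite unlock.
transitivity (\int[distribution P Y]_x (EFin \o g) x)%E.
  rewrite ge0_integral_distribution// => x.
  by rewrite lee_fin; have /andP[] := g01 x.
rewrite (integral_density (nu := distribution P Y)
  (integrable_exponential_pdf r0) expX)//; last first.
  (* [g] is bounded by 1 and the law is a finite measure. *)
  apply: (@le_integrable _ _ _ _ _ measurableT _ (cst 1%E)) => //.
    move=> x _ /=; rewrite normr1 ger0_norm ?lee_fin; have /andP[//] := g01 x.
  exact: finite_measure_integrable_cst.
rewrite -integral_exponential_pdf_tilt//; last exact: ltr_wpDr.
(* The truncation disappears here: on the negatives the density is 0. *)
apply: eq_integral => x _; rewrite /= -EFinM /g; case: ifPn => // x0.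
by rewrite lt0_exponential_pdf ?mulr0// ltNge.
Qed.

End exponential_law.

(** The density is 1 on [[0, 1]] and 0 elsewhere, so only the length of the trace of [U] counts. A
    general [U] covers half-lines ending inside [[0, 1]] as well as beyond it. *)
Lemma integral_uniform_pdf01 (R : realType) (t : R) (U : set R) :
  0 <= t -> U `&` `[0, 1] = `[0, t]%classic ->
  (\int[lebesgue_measure]_(x in U) (uniform_pdf 0 1 x)%:E = t%:E)%E.
Proof.
move=> t0 Ut; rewrite integral_uniform_pdf Ut.
rewrite (eq_integral (cst 1%E)); last first.
  move=> x; rewrite -Ut inE /= in_itv/= => -[_ x01].
  by rewrite /uniform_pdf x01 subr0 invr1.
rewrite integral_cst//= mul1e lebesgue_measure_itv/= lte_fin.
by case: ltgtP t0 => // [_|<-] _; rewrite ?oppr0 ?adde0.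
Qed.

Lemma uniform_prob01_itvNyc (R : realType) (t : R) :
  uniform_prob (@ltr01 R) `]-oo, t] =
  (if t <= 0 then 0 else if 1 <= t then 1 else t)%:E.
Proof.
rewrite /uniform_prob; case: ifPn => [t0|].
  (* For [t <= 0] the half-line meets [[0, 1]] at most in the point 0. *)
  rewrite integral_uniform_pdf (integral_Sset1 0)// => x [].
  rewrite /= !in_itv/= => xt /andP[x0 _]; apply/eqP.
  by rewrite eq_le x0 (le_trans xt).
rewrite -ltNge => t0; have [t1|t1] := leP 1 t; apply: integral_uniform_pdf01;
  rewrite ?ltW//.
  apply/seteqP; split=> x /=; rewrite !in_itv/=; first by case.
  by move=> /andP[x0 x1]; rewrite x0 x1 (le_trans x1).
apply/seteqP; split=> x /=; rewrite !in_itv/=; first by case=> -> /andP[->].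
by move=> /andP[x0 xt]; rewrite x0 xt (le_trans xt) ?ltW.
Qed.

Lemma uniform_prob01_itvoo (R : realType) :
  uniform_prob (@ltr01 R) `]0, 1[ = 1%E.
Proof.
(* Both endpoints are Lebesgue-null, so they are added to reach the total mass over [[0, 1]]. *)
rewrite /uniform_prob integral_itv_bndo_bndc; last first.
  apply/measurable_funTS/measurableT_comp => //; exact: measurable_uniform_pdf.
rewrite integral_itv_obnd_cbnd; last first.
  apply/measurable_funTS/measurableT_comp => //; exact: measurable_uniform_pdf.
exact: integral_uniform_pdf1.
Qed.

Lemma measurable_kies_cdf d (T : measurableType d) (R : realType)
    (f g : T -> R) (t : R) :
  measurable_fun setT f -> measurable_fun setT g ->
  measurable_fun setT (fun w => kies_cdf (f w) (g w) t).
Proof.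
move=> mf mg; rewrite /kies_cdf; case: (t <= 0) => //; case: (1 <= t) => //.
apply: measurable_funB => //; apply: measurableT_comp => //.
apply: measurableT_comp => //; apply: measurable_funM => //.
exact: measurableT_comp (measurable_powRr _) mg.
Qed.

Theorem proposition5p2 (R : realType) (d : measure_display)
    (T : measurableType d) (P : probability T R) (lambda beta : {RV P >-> R}) :
  exponentially_distributed lambda 1 ->
  {ae P, forall w, beta w = 1} ->
  is_kies_mixture lambda beta (uniform_prob (@ltr01 R)).
Proof.
move=> explambda beta1.
have lambda0 := exponentially_distributed_gt0 explambda.
split=> //.
- by apply: filterS beta1 => w ->.
- exact: uniform_prob01_itvoo.
move=> t; rewrite /= uniform_prob01_itvNyc /kies_mixture_cdf.
(* Outside [(0, 1)] the integrand does not depend on [w]. *)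
have [t0|t0] := leP t 0.
  by rewrite /kies_cdf t0 expectation_cst.
have [t1|t1] := leP 1 t.
  by rewrite /kies_cdf leNgt t0/= t1 expectation_cst.
pose s := t / (1 - t).
have s0 : 0 <= s by rewrite divr_ge0 ?subr_ge0 ?ltW.
transitivity (1 - 1 / (1 + s))%:E.
  by congr EFin; rewrite /s; field; lra.
rewrite -(expectation_onem_expR_exponential ltr01 explambda _ s0) unlock.
(* The truncated integrand and [kies_cdf] are compared only almost surely, where [lambda] is
   positive and [beta] is 1. *)
apply: ae_eq_integral => //.
- apply/measurable_EFinP; apply: measurable_fun_ifT => //.
    exact: measurable_fun_ler.
  apply: measurable_funB => //; apply: measurableT_comp => //.
  by apply: measurableT_comp => //; exact: measurable_funM.
- by apply/measurable_EFinP; apply: measurable_kies_cdf.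
- apply: filterS2 lambda0 beta1 => w l0 b1 _ /=.
  rewrite /kies_cdf [t <= 0]leNgt t0 [1 <= t]leNgt t1 b1 powRr1//= ltW//.
  by rewrite (mulrC s).
Qed.
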